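(* Let $G$ be an additive subgroup of $\mathbb C$ with $\mathbb Z\subseteq G$ and $\frac1k\notin G$ for every integer $k>1$, let $\lambda\in\mathbb C$, and let $\mathfrak g=\mathfrak g(G,\lambda)$. Then for every $a\in G$ with $a\neq0$, $$(\mathrm{Der}\,\mathfrak g)_a=\mathrm{span}_{\mathbb C}\{\mathrm{ad}\,L_a,\ \mathrm{ad}\,I_a\},$$ and $$(\mathrm{Der}\,\mathfrak g)_0=\mathrm{span}_{\mathbb C}\{\varphi,\ \psi,\ \sigma_{(0)},\ \sigma_{(-1)},\ \sigma_{(-2)},\ \xi_{\mathcal A},\ \eta_{\mathcal A,1}\mid \mathcal A\in\mathrm{Hom}(G,\mathbb C)\}.$$
   Context: For an additive subgroup $G\subseteq\mathbb C$ and $\lambda\in\mathbb C$, $\mathfrak g(G,\lambda)$ is the complex Lie algebra with basis $\{L_a,I_a\mid a\in G\}$ and brackets $[L_a,L_b]=(b-a)L_{a+b}$, $[L_a,I_b]=(b-\lambda a)I_{a+b}$, $[I_a,I_b]=0$. It is $G$-graded by $\mathfrak g_a=\mathrm{span}_{\mathbb C}\{L_a,I_a\}$, and for $a\in G$, $(\mathrm{Der}\,\mathfrak g)_a$ denotes the space of derivations $\sigma$ of $\mathfrak g$ with $\sigma(\mathfrak g_b)\subseteq\mathfrak g_{a+b}$ for all $b\in G$. $\mathrm{Hom}(G,\mathbb C)$ is the set of additive group homomorphisms $G\to\mathbb C$. The following linear maps $\mathfrak g\to\mathfrak g$ are used (for all $a\in G$, $\mathcal A\in \mathrm{Hom}(G,\mathbb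 C)$; $\delta$ is the Kronecker delta, so some of the maps are zero unless $\lambda$ has the indicated value): - $\varphi(L_a)=aI_a,\ \varphi(I_a)=0$; - $\psi(L_a)=0,\ \psi(I_a)=I_a$; - $\sigma_{(0)}(L_a)=\delta_{\lambda,0}I_a,\ \sigma_{(0)}(I_a)=0$; - $\sigma_{(-1)}(L_a)=\delta_{\lambda,-1}a^2I_a,\ \sigma_{(-1)}(I_a)=0$; - $\sigma_{(-2)}(L_a)=\delta_{\lambda,-2}a^3I_a,\ \sigma_{(-2)}(I_a)=0$; - $\xi_{\mathcal A}(L_a)=\mathcal A(a)L_a,\ \xi_{\mathcal A}(I_a)=\mathcal A(a)I_a$; - $\eta_{\mathcal A,1}(L_a)=\delta_{\lambda,1}\mathcal A(a)I_a,\ \eta_{\mathcal A,1}(I_a)=0$. *)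

(* Defs.v *)
From HB Require Import structures.
From mathcomp Require Import all_boot all_order all_algebra.
From mathcomp Require Import boolp classical_sets functions reals complex.
From mathcomp Require Import finmap.
From mathcomp.multinomials Require Import monalg.
From mathcomp Require Import ring.

Set Implicit Arguments.
Unset Strict Implicit.
Unset Printing Implicit Defensive.

Import GRing.Theory Num.Theory.
Local Open Scope ring_scope.
Local Open Scope classical_set_scope.

(* Linear span of a possibly infinite family, as the set of all finite linear
   combinations. *)
Definition lspan (F : fieldType) (V : lmodType F) (S : set V) : set V :=
  [set v | exists (n : nat) (c : 'I_n -> F) (s : 'I_n -> V),
     (forall i, S (s i)) /\ v = \sum_(i < n) c i *: s i].

HB.mixin Record Lmodule_isLieAlgebra (F : fieldType) V of GRing.Lmodule F V := {
  lie : V -> V -> V;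
  lie_linearl : forall y, linear (fun x => lie x y);
  lie_linearr : forall x, linear (lie x);
  lie_alt : forall x, lie x x = 0;
  lie_jacobi : forall x y z,
    lie x (lie y z) + lie y (lie z x) + lie z (lie x y) = 0
}.

#[short(type="lieAlgType")]
HB.structure Definition LieAlgebra (F : fieldType) :=
  { V of GRing.Lmodule F V & Lmodule_isLieAlgebra F V }.

Definition ad (F : fieldType) (L : lieAlgType F) (x : L) : L -> L :=
  fun y => lie x y.

Definition derivation (F : fieldType) (L : lieAlgType F) (s : L -> L) : Prop :=
  linear s /\ forall x y, s (lie x y) = lie (s x) y + lie x (s y).

(* The linear map on the free module {malg F[B]} with prescribed values on the
   basis B. *)
HB.lock Definition lin_ext (F : fieldType) (B : choiceType) (V : lmodType F)
    (f : B -> V) (x : {malg F[B]}) : V :=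
  \sum_(k <- msupp x) x@_k *: f k.

Section LinearExtension.
Variables (F : fieldType) (B : choiceType) (V : lmodType F).
Implicit Types (f : B -> V).

Lemma lin_ext_w f (x : {malg F[B]}) (d : {fset B}) :
  (msupp x `<=` d)%fset -> lin_ext f x = \sum_(k <- d) x@_k *: f k.
Proof.
move=> sub; rewrite lin_ext.unlock (big_fset_incl _ sub) // => k _ kx.
by rewrite mcoeff_outdom // scale0r.
Qed.

Lemma lin_extP f : linear (lin_ext f).
Proof.
move=> c x y; pose d := (msupp (c *: x + y) `|` (msupp x `|` msupp y))%fset.
rewrite (@lin_ext_w f (c *: x + y) d) ?fsubsetUl //.
rewrite (@lin_ext_w f x d); last by rewrite /d fsetUCA fsubsetUl.
rewrite (@lin_ext_w f y d); last by rewrite /d fsetUA fsubsetUr.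
rewrite scaler_sumr -big_split; apply: eq_bigr => k _ /=.
by rewrite mcoeffD mcoeffZ scalerDl scalerA.
Qed.

Lemma lin_extU f k : lin_ext f << k >> = f k.
Proof. by rewrite lin_ext.unlock msuppU oner_eq0 big_seq_fset1 mcoeffUU scale1r. Qed.

End LinearExtension.

Lemma malg_lin_ind (F : fieldType) (B : choiceType) (P : {malg F[B]} -> Prop) :
  (forall k, P << k >>) -> P 0 ->
  (forall c x y, P x -> P y -> P (c *: x + y)) -> forall x, P x.
Proof.
move=> PU P0 PD x; rewrite [x]monalgE.
elim: (enum_fset (msupp x)) => [|k s IH]; first by rewrite big_nil.
rewrite big_cons.
suff -> : << x@_k *g k >> = x@_k *: << k >> by exact: PD.
by apply/malgP => l; rewrite mcoeffZ !mcoeffU mulr_natr.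
Qed.

Definition carrier (C : numFieldType) (G : zmodClosed C) : Type :=
  {x : C | x \in G}.

HB.instance Definition _ (C : numFieldType) (G : zmodClosed C) :=
  SubChoice.on (carrier G).
HB.instance Definition _ (C : numFieldType) (G : zmodClosed C) :=
  [SubChoice_isSubZmodule of carrier G by <:].

(* The basis is indexed by two copies of G: inl a stands for L_a, and inr a for
   I_a.  The parameter lambda only enters through the bracket. *)
Definition galg (C : numFieldType) (G : zmodClosed C) (lambda : C) : Type :=
  {malg C[(carrier G + carrier G)%type]}.

HB.instance Definition _ (C : numFieldType) (G : zmodClosed C) (lambda : C) :=
  GRing.Lmodule.on (galg G lambda).

HB.lock Definition Lgen (C : numFieldType) (G : zmodClosed C) (lambda : C)
  (a : carrier G) : galg G lambda := << (inl a : (carrier G + carrier G)%type) >>.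

HB.lock Definition Igen (C : numFieldType) (G : zmodClosed C) (lambda : C)
  (a : carrier G) : galg G lambda := << (inr a : (carrier G + carrier G)%type) >>.

Section Galg.
Variables (C : numFieldType) (G : zmodClosed C) (lambda : C).
Local Notation T := (carrier G).
Local Notation g := (galg G lambda).
Local Notation Lgen := (Lgen lambda).
Local Notation Igen := (Igen lambda).
Implicit Types (a b c : T).

Lemma galg_ind (P : g -> Prop) :
  (forall a, P (Lgen a)) -> (forall a, P (Igen a)) -> P 0 ->
  (forall (k : C) x y, P x -> P y -> P (k *: x + y)) -> forall x, P x.
Proof.
rewrite Lgen.unlock Igen.unlock => PL PI P0 PD.
by apply: malg_lin_ind => // -[a|a]; [exact: PL|exact: PI].
Qed.

Definition gext (V : lmodType C) (fL fI : T -> V) : g -> V :=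
  lin_ext (fun k : (T + T)%type =>
             match k with inl a => fL a | inr a => fI a end).

Lemma gext_linear (V : lmodType C) (fL fI : T -> V) : linear (gext fL fI).
Proof. exact: lin_extP. Qed.

Lemma gextL (V : lmodType C) (fL fI : T -> V) a : gext fL fI (Lgen a) = fL a.
Proof. by rewrite Lgen.unlock /gext lin_extU. Qed.

Lemma gextI (V : lmodType C) (fL fI : T -> V) a : gext fL fI (Igen a) = fI a.
Proof. by rewrite Igen.unlock /gext lin_extU. Qed.

End Galg.

HB.lock Definition gbracket (C : numFieldType) (G : zmodClosed C) (lambda : C)
    (x y : galg G lambda) : galg G lambda :=
  gext
    (fun a => gext (fun b => (\val b - \val a) *: Lgen lambda (a + b))
                   (fun b => (\val b - lambda * \val a) *: Igen lambda (a + b)) y)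
    (fun a => gext (fun b => - ((\val a - lambda * \val b) *: Igen lambda (b + a)))
                   (fun b => 0) y)
    x.

Section Bracket.
Variables (C : numFieldType) (G : zmodClosed C) (lambda : C).
Local Notation T := (carrier G).
Local Notation g := (galg G lambda).
Local Notation Lgen := (Lgen lambda).
Local Notation Igen := (Igen lambda).
Implicit Types (a b c : T) (x y z : g).

Lemma gbracketLL a b :
  gbracket (Lgen a) (Lgen b) = (\val b - \val a) *: Lgen (a + b).
Proof. by rewrite gbracket.unlock gextL gextL. Qed.

Lemma gbracketLI a b :
  gbracket (Lgen a) (Igen b) = (\val b - lambda * \val a) *: Igen (a + b).
Proof. by rewrite gbracket.unlock gextL gextI. Qed.

Lemma gbracketIL a b :
  gbracket (Igen a) (Lgen b) = - ((\val a - lambda * \val b) *: Igen (b + a)).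
Proof. by rewrite gbracket.unlock gextI gextL. Qed.

Lemma gbracketII a b : gbracket (Igen a) (Igen b) = 0.
Proof. by rewrite gbracket.unlock gextI gextI. Qed.

Lemma gbracket_linearl y : linear (fun x : g => gbracket x y).
Proof. by rewrite gbracket.unlock; exact: gext_linear. Qed.

Let gbracket0l y : gbracket 0 y = 0.
Proof.
have := gbracket_linearl y 1 0 0; rewrite !scale1r addr0 => e.
by apply: (addIr (gbracket 0 y)); rewrite add0r -e.
Qed.

Lemma gbracket_linearr x : linear (gbracket x).
Proof.
move=> k y z; move: x; apply: galg_ind => [a|a||h u v Hu Hv].
- by rewrite gbracket.unlock !gextL gext_linear.
- by rewrite gbracket.unlock !gextI gext_linear.
- by rewrite !gbracket0l scaler0 addr0.
by rewrite 3!gbracket_linearl Hu Hv !scalerDr !scalerA [h * k]mulrC addrACA.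
Qed.

Let gbracket0r x : gbracket x 0 = 0.
Proof.
have := gbracket_linearr x 1 0 0; rewrite !scale1r addr0 => e.
by apply: (addIr (gbracket x 0)); rewrite add0r -e.
Qed.

Lemma gbracket_antisym x y : gbracket x y = - gbracket y x.
Proof.
move: x; apply: galg_ind => [a|a||k u v]; first 2 last.
- by rewrite gbracket0l gbracket0r oppr0.
- by move=> Hu Hv; rewrite gbracket_linearl gbracket_linearr Hu Hv opprD scalerN.
- move: y; apply: galg_ind => [b|b||k u v].
  + by rewrite !gbracketLL [b + a]addrC -scaleNr opprB.
  + by rewrite gbracketLI gbracketIL opprK.
  + by rewrite gbracket0l gbracket0r oppr0.
  by move=> Hu Hv; rewrite gbracket_linearl gbracket_linearr Hu Hv opprD scalerN.
move: y; apply: galg_ind => [b|b||k u v].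
- by rewrite gbracketLI gbracketIL.
- by rewrite !gbracketII oppr0.
- by rewrite gbracket0l gbracket0r oppr0.
by move=> Hu Hv; rewrite gbracket_linearl gbracket_linearr Hu Hv opprD scalerN.
Qed.

Lemma gbracket_alt x : gbracket x x = 0.
Proof.
have /eqP := gbracket_antisym x x.
rewrite -addr_eq0 -mulr2n -scaler_nat scaler_eq0 pnatr_eq0 /=.
by move=> /eqP.
Qed.

Let gbZl k x y : gbracket (k *: x) y = k *: gbracket x y.
Proof. by rewrite -[k *: x]addr0 gbracket_linearl gbracket0l addr0. Qed.

Let gbZr k x y : gbracket x (k *: y) = k *: gbracket x y.
Proof. by rewrite -[k *: y]addr0 gbracket_linearr gbracket0r addr0. Qed.

Let gbNr x y : gbracket x (- y) = - gbracket x y.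
Proof. by rewrite -scaleN1r gbZr scaleN1r. Qed.

Let jac (x y z : g) : g := gbracket x (gbracket y z) +
  gbracket y (gbracket z x) + gbracket z (gbracket x y).

Let jac_rot x y z : jac x y z = jac y z x.
Proof. by rewrite /jac -addrA addrC. Qed.

Let jac_lin y z : linear (fun x => jac x y z).
Proof.
move=> k u v; rewrite /jac !gbracket_linearl !gbracket_linearr.
by rewrite [X in X + _ = _]addrACA [LHS]addrACA -!scalerDr.
Qed.

Let jac_ind y z :
  (forall a, jac (Lgen a) y z = 0) -> (forall a, jac (Igen a) y z = 0) ->
  forall x, jac x y z = 0.
Proof.
move=> PL PI; apply: galg_ind => // [|k u v Hu Hv].
  by have := jac_lin y z (-1) 0 0; rewrite !scaleN1r oppr0 addr0 addNr.
by rewrite jac_lin Hu Hv scaler0 addr0.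
Qed.

Let gbE := (gbracketLL, gbracketLI, gbracketIL, gbracketII, gbZr, gbNr,
  gbracket0r, scaler0, oppr0).

Let jacLLL a b c : jac (Lgen a) (Lgen b) (Lgen c) = 0.
Proof.
rewrite /jac !gbE !scalerA.
rewrite [b + (c + a)]addrC [c + (a + b)]addrC -[c + a + b]addrA [c + (a + b)]addrC.
rewrite -[a + b + c]addrA -!scalerDl -[RHS](scale0r (Lgen (a + (b + c)))).
by congr (_ *: _); rewrite !raddfD /=; ring.
Qed.

Let jacLLI a b c : jac (Lgen a) (Lgen b) (Igen c) = 0.
Proof.
rewrite /jac !gbE !scalerN !scalerA -!scaleNr.
rewrite [b + (a + c)]addrCA -[a + b + c]addrA.
rewrite -!scalerDl -[RHS](scale0r (Igen (a + (b + c)))).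
by congr (_ *: _); rewrite !raddfD /=; ring.
Qed.

Let jacLII a b c : jac (Lgen a) (Igen b) (Igen c) = 0.
Proof. by rewrite /jac !gbE !addr0. Qed.

Let jacIII a b c : jac (Igen a) (Igen b) (Igen c) = 0.
Proof. by rewrite /jac !gbE !addr0. Qed.

Lemma gbracket_jacobi x y z : gbracket x (gbracket y z) +
  gbracket y (gbracket z x) + gbracket z (gbracket x y) = 0.
Proof.
rewrite -/(jac x y z); move: x; apply: jac_ind => a; rewrite jac_rot;
  move: y; apply: jac_ind => b; rewrite jac_rot;
  move: z; apply: jac_ind => c.
- exact: jacLLL.
- by rewrite jac_rot jacLLI.
- exact: jacLLI.
- by rewrite jac_rot jacLII.
- by rewrite 2!jac_rot jacLLI.
- by rewrite 2!jac_rot jacLII.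
- exact: jacLII.
- exact: jacIII.
Qed.

HB.instance Definition _ := Lmodule_isLieAlgebra.Build C g
  gbracket_linearl gbracket_linearr gbracket_alt gbracket_jacobi.

End Bracket.

Section Derivations.
Variables (C : numFieldType) (G : zmodClosed C) (lambda : C).
Local Notation T := (carrier G).
Local Notation g := (galg G lambda).
Local Notation Lgen := (Lgen lambda).
Local Notation Igen := (Igen lambda).

Definition ghom (a : T) : set g := lspan [set Lgen a; Igen a].

(* A set of maps g -> g, viewed inside the vector space of all functions. *)
Definition Der (a : T) : set (g -> g) :=
  [set s | derivation s /\ forall b, s @` ghom b `<=` ghom (a + b)].

Definition phi : g -> g := gext (fun a => \val a *: Igen a) (fun=> 0).

Definition psi : g -> g := gext (fun=> 0) Igen.

Definition sigma0 : g -> g :=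
  gext (fun a => (lambda == 0)%:R *: Igen a) (fun=> 0).

Definition sigmaN1 : g -> g :=
  gext (fun a => ((lambda == -1)%:R * \val a ^+ 2) *: Igen a) (fun=> 0).

Definition sigmaN2 : g -> g :=
  gext (fun a => ((lambda == -2)%:R * \val a ^+ 3) *: Igen a) (fun=> 0).

Definition xi (A : {additive T -> C}) : g -> g :=
  gext (fun a => A a *: Lgen a) (fun a => A a *: Igen a).

Definition eta1 (A : {additive T -> C}) : g -> g :=
  gext (fun a => ((lambda == 1)%:R * A a) *: Igen a) (fun=> 0).

End Derivations.

Arguments ghom {C G} lambda a.
Arguments Der {C G} lambda a.
Arguments phi {C} G lambda.
Arguments psi {C} G lambda.
Arguments sigma0 {C} G lambda.
Arguments sigmaN1 {C} G lambda.
Arguments sigmaN2 {C} G lambda.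
Arguments xi {C G} lambda A.
Arguments eta1 {C G} lambda A.

(* Main.v *)
From HB Require Import structures.
Require Import Defs.
From mathcomp Require Import all_boot all_order all_algebra.
From mathcomp Require Import boolp classical_sets functions reals complex.
From mathcomp Require Import ring.

(** The element L_0 acts on the homogeneous component of degree b as the scalar
    b.  Applying a derivation s of degree a to [L_0, x], with x of degree b,
    therefore gives b s(x) = [s(L_0), x] + (a + b) s(x), that is,
    a s(x) = - [s(L_0), x].  For a != 0 this exhibits s as the inner derivation
    ad (- s(L_0) / a), and s(L_0) is a combination of L_a and I_a
    ([Der_inner]).

    In degree 0 write s(L_a) = A(a) L_a + B(a) I_a and
    s(I_a) = E(a) L_a + D(a) I_a.  The Leibniz rule on generators becomes a
    system of functional equations for the four coefficients
    ([derivation_components]), and evaluating it at 1 and at multiples of a given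
    element solves it:
    - A is additive up to a factor b - a, hence additive
      ([additive_off_diagonal]);
    - E vanishes ([no_IL_component]);
    - D - A is constant ([II_component]);
    - B is a 1-cocycle of the Witt algebra of G with values in the module
      spanned by the I_a ([cocycleP]).

    So A contributes xi_A, the constant D - A contributes a multiple of psi, and
    the cocycle B gives the rest.  The map a |-> a is always a cocycle, and so is the
    constant B(0), because lambda B(0) = 0; subtracting them, one may assume
    B(0) = B(1) = 0.  If lambda = 1 the cocycle equation is again additivity
    up to a factor b - a.  Otherwise the equation for the pairs (a, 1) and
    (a + 1, -1) gives two linear relations between B(a), B(a + 1) and B(-1);
    eliminating B(a + 1) leaves

      (1 - lambda) (2 + lambda) B(a) = lambda (a - a^2) B(-1),

    where (1 + lambda) B(-1) = 0 ([cocycle_rigid], [cocycle_N1]).  This settles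
    every lambda except 1 and -2.  For lambda = -2 the left-hand side degenerates
    because a^3 - a is a cocycle vanishing at 0, 1 and -1; after subtracting a
    multiple of it B(2) = 0 as well, and comparing the step by 2 with two steps
    by 1 forces 12 B = 0 ([cocycle_rigid_N2]). *)

Set Implicit Arguments.
Unset Strict Implicit.
Unset Printing Implicit Defensive.

Import GRing.Theory Num.Theory.
Local Open Scope ring_scope.
Local Open Scope complex_scope.
Local Open Scope classical_set_scope.

(** * Linear spans *)

Section Span.
Variables (F : fieldType) (V : lmodType F).
Implicit Types (S P : set V) (u v : V).

Lemma mem_lspan S v : S v -> lspan S v.
Proof.
move=> Sv; exists 1%N, (fun=> 1), (fun=> v); split=> //.
by rewrite big_ord1 scale1r.
Qed.

Lemma lspan0 S : lspan S 0.
Proof.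
by exists 0%N, (fun=> 0), (fun=> 0); split; [case | rewrite big_ord0].
Qed.

Lemma lspan_comb S k u v : lspan S u -> lspan S v -> lspan S (k *: u + v).
Proof.
move=> [m [c [s [Ss ->]]]] [n [d [t [St ->]]]].
exists (m + n)%N,
  (fun i : 'I_(m + n) => match fintype.split i with inl j => k * c j | inr j => d j end),
  (fun i : 'I_(m + n) => match fintype.split i with inl j => s j | inr j => t j end).
split=> [i|]; first by case: (fintype.split i).
rewrite big_split_ord scaler_sumr; congr (_ + _); apply: eq_bigr => i _.
  by rewrite (unsplitK (inl i : 'I_m + 'I_n)) scalerA.
by rewrite (unsplitK (inr i : 'I_m + 'I_n)).
Qed.

Lemma lspanZ S k v : lspan S v -> lspan S (k *: v).
Proof. by move=> Sv; rewrite -[k *: v]addr0; apply: lspan_comb => //; exact: lspan0. Qed.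

Lemma lspan_min S P : P 0 -> (forall k u v, P u -> P v -> P (k *: u + v)) ->
  S `<=` P -> lspan S `<=` P.
Proof.
move=> P0 Pcomb SP _ [n [c [s [Ss ->]]]].
elim: n c s Ss => [|n IHn] c s Ss; first by rewrite big_ord0.
by rewrite big_ord_recl; apply: Pcomb; [exact/SP | apply: IHn].
Qed.

Lemma lspan2P u v w :
  lspan [set u; v] w <-> exists p q, w = p *: u + q *: v.
Proof.
split=> [|[p [q ->]]].
  apply: (@lspan_min _ [set w | exists p q, w = p *: u + q *: v]).
  - by exists 0, 0; rewrite !scale0r addr0.
  - move=> k _ _ [p [q ->]] [p' [q' ->]]; exists (k * p + p'), (k * q + q').
    by rewrite scalerDr !scalerA !scalerDl addrACA.
  - by move=> _ [|] -> /=; [exists 1, 0 | exists 0, 1];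
      rewrite scale1r scale0r ?addr0 ?add0r.
by apply: lspan_comb; [|apply: lspanZ]; apply: mem_lspan; [left | right].
Qed.

End Span.

(** * Functional equations on the grading group *)

(** Proves an identity that follows linearly from a hypothesis: chaining it with
    suitable multipliers k reduces the goal to a polynomial identity. *)
Lemma eq_by_comb (R : pzRingType) (k l r x y : R) :
  l = r -> x - y = k * (l - r) -> x = y.
Proof. by move=> ->; rewrite subrr mulr0 => /subr0_eq. Qed.

Section FunctionalEquations.
Variables (C : numFieldType) (G : zmodClosed C).
Local Notation T := (carrier G).
Implicit Types (a b : T) (f : T -> C).

Lemma val_carrierD a b : \val (a + b) = \val a + \val b.
Proof. exact: raddfD. Qed.

Lemma val_carrierN a : \val (- a) = - \val a.
Proof. exact: raddfN. Qed.

Lemma val_carrier0 : \val (0 : T) = 0.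
Proof. exact: raddf0. Qed.

Definition valE := (val_carrierD, val_carrierN, val_carrier0).

Lemma val_carrier_eq0 a : (\val a == 0) = (a == 0).
Proof. by rewrite -val_carrier0 (inj_eq val_inj). Qed.

(** Dividing by b - a loses the case a = b, which is recovered by decomposing 5 a
    into distinct multiples of a in two ways. *)
Lemma additive_off_diagonal one f : \val (one : T) = 1 ->
  (forall a b, (\val b - \val a) * f (a + b) = (\val b - \val a) * (f a + f b)) ->
  forall a b, f (a + b) = f a + f b.
Proof.
move=> one1 fE.
have fD a b : \val b - \val a != 0 -> f (a + b) = f a + f b.
  by move=> ne; apply: (mulfI ne).
have multD a m n : a != 0 -> (m != n)%N ->
    f (a *+ (m + n)) = f (a *+ m) + f (a *+ n).
  move=> a0 mn; rewrite mulrnDr fD //.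
  have -> : \val (a *+ n) - \val (a *+ m) = (n%:R - m%:R) * \val a.
    by rewrite mulrBl !mulr_natl -!raddfMn.
  by rewrite mulf_neq0 ?val_carrier_eq0 // subr_eq0 eqr_nat eq_sym.
move=> a b; have [ab|/fD //] := eqVneq (\val b - \val a) 0.
have {ab}-> : b = a by apply/val_inj/subr0_eq.
have [->|a0] := eqVneq a 0.
  have := @fD 0 one; rewrite one1 val_carrier0 subr0 oner_eq0 => /(_ isT).
  by rewrite add0r -[LHS]add0r addr0 => /addIr <-; rewrite addr0.
(* f (2 a) + f (3 a) = f (5 a) = f a + f (4 a) = f a + (f a + f (3 a)) *)
have h13 := multD a 1%N 3%N a0 isT.
have h23 := multD a 2%N 3%N a0 isT; have := multD a 1%N 4%N a0 isT.
by rewrite -[(1 + 4)%N]/(2 + 3)%N h23 h13 addrA => /addIr.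
Qed.

(** For the action [L_a, I_b] = (b - lambda a) I_(a + b) of the Witt algebra, this
    is the condition for L_a |-> f(a) I_a to be a 1-cocycle. *)
Definition cocycle lambda f := forall a b, (\val b - \val a) * f (a + b) =
  (\val b - lambda * \val a) * f b - (\val a - lambda * \val b) * f a.

Lemma cocycle_at0 lambda f one : \val (one : T) = 1 -> cocycle lambda f ->
  lambda * f 0 = 0.
Proof.
move=> one1 /(_ 0 one); rewrite add0r one1 val_carrier0 => e.
by apply: (eq_by_comb (k := -1) e); ring.
Qed.

Lemma cocycle_comb lambda k f h : cocycle lambda f -> cocycle lambda h ->
  cocycle lambda (fun a => f a - k * h a).
Proof.
move=> fc hc a b.
transitivity ((\val b - \val a) * f (a + b) -
  k * ((\val b - \val a) * h (a + b))); first by ring.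
by rewrite fc hc; ring.
Qed.

Lemma cocycle_val lambda : cocycle lambda (fun a => \val a).
Proof. by move=> a b; rewrite !valE; ring. Qed.

Lemma cocycle_const lambda c : lambda * c = 0 -> cocycle lambda (fun=> c).
Proof. by move=> lc a b; apply: (eq_by_comb (k := \val a - \val b) lc); ring. Qed.

Lemma cocycle_sqr : cocycle (-1) (fun a => \val a ^+ 2).
Proof. by move=> a b; rewrite !valE; ring. Qed.

Lemma cocycle_cube : cocycle (-2) (fun a => \val a ^+ 3).
Proof. by move=> a b; rewrite !valE; ring. Qed.

Lemma cocycle_additive (f : {additive T -> C}) : cocycle 1 f.
Proof. by move=> a b; rewrite raddfD; ring. Qed.

Lemma cocycle_delta lambda m f : (lambda = m -> cocycle lambda f) ->
  cocycle lambda (fun a => (lambda == m)%:R * f a).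
Proof.
move=> fc a b; case: eqP => [/fc/(_ a b) e|_]; last by rewrite mulr0n; ring.
by rewrite mulr1n; apply: (eq_by_comb (k := 1) e); ring.
Qed.

(** With f(1) = 0, the cocycle equation at (a, 1) is a first-order recurrence. *)
Lemma cocycle_step lambda f one : \val (one : T) = 1 -> cocycle lambda f ->
  f one = 0 -> forall a,
  (1 - \val a) * f (a + one) = - ((\val a - lambda) * f a).
Proof. by move=> one1 fc f1 a; rewrite -one1 fc f1 one1; ring. Qed.

(** The cocycle equation at (1, -1): a nonzero f(-1) requires lambda = -1. *)
Lemma cocycle_N1 lambda f one : \val (one : T) = 1 -> cocycle lambda f ->
  f 0 = 0 -> f one = 0 -> (1 + lambda) * f (- one) = 0.
Proof.
move=> one1 fc f0 f1.
have := fc one (- one); rewrite subrr f0 f1 !valE one1 => e.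
by apply: (eq_by_comb (k := 1) e); ring.
Qed.

(** Stepping up from a to a + 1 and back down relates f(a) to itself; the two
    coefficients differ by (1 - lambda) (2 + lambda), which does not depend on
    a, so f(a) is determined by f(-1) unless lambda is 1 or -2. *)
Lemma cocycle_rigid lambda f one : \val (one : T) = 1 -> cocycle lambda f ->
  f 0 = 0 -> f one = 0 ->
  forall a, (1 - lambda) * (2 + lambda) * f a =
    lambda * (\val a - \val a ^+ 2) * f (- one).
Proof.
move=> one1 fc f0 f1 a.
have fN1 := cocycle_N1 one1 fc f0 f1.
have up := cocycle_step one1 fc f1 a.
have := fc (a + one) (- one); rewrite addrK !valE one1 => down.
apply: (eq_by_comb (k := 1 - \val a) fN1).
apply: (eq_by_comb (k := \val a + 1 + lambda) up).
apply: (eq_by_comb (k := \val a - 1) down).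
by ring.
Qed.

(** At lambda = -2 the step by 1 and its reverse are equivalent, but f(a + 2) can be
    reached from f(a) by one step of length 2 or by two of length 1.  The two
    resulting cubic coefficients differ by the constant 12. *)
Lemma cocycle_rigid_N2 f one : \val (one : T) = 1 -> cocycle (-2) f ->
  f one = 0 -> f (one + one) = 0 -> forall a, f a = 0.
Proof.
move=> one1 fc f1 f2 a.
have s0 := cocycle_step one1 fc f1 a.
have s1 := cocycle_step one1 fc f1 (a + one).
have := fc a (one + one); rewrite f2 addrA.
move: s1 s0; rewrite !valE one1; set x := \val a => s1 s0 d.
suff /eqP : 12 * f a = 0 by rewrite mulf_eq0 pnatr_eq0 => /eqP.
apply: (eq_by_comb (k := (2 - x) * (x + 3)) s0).
apply: (eq_by_comb (k := - ((1 - x) * (2 - x))) s1).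
apply: (eq_by_comb (k := - (x * (1 - x))) d).
by ring.
Qed.

(** The part of [cocycleP] away from lambda = 1.  Subtracting f(0), which is a
    cocycle as lambda f(0) = 0, and a multiple of a |-> a leaves a cocycle h with
    h(0) = h(1) = 0, to which the rigidity lemmas apply. *)
Lemma cocycle_classification lambda f one : \val (one : T) = 1 ->
  lambda != 1 -> cocycle lambda f ->
  exists c s0 s1 s2 : C, forall a, f a = c * \val a + (lambda == 0)%:R * s0 +
    (lambda == -1)%:R * s1 * \val a ^+ 2 + (lambda == -2)%:R * s2 * \val a ^+ 3.
Proof.
move=> one1 l1 fc.
have l0 := cocycle_at0 one1 fc.
have f0E : f 0 = (lambda == 0)%:R * f 0.
  by move/eqP: l0; rewrite mulf_eq0; case: eqP => _; rewrite ?mul1r ?mul0r // => /eqP.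
set c := f one - f 0.
have := cocycle_comb 1 fc (cocycle_const l0).
move=> /cocycle_comb-/(_ c _ (@cocycle_val lambda)); set h := fun a => _ => hc.
have h0 : h 0 = 0 by rewrite /h val_carrier0; ring.
have h1 : h one = 0 by rewrite /h /c one1; ring.
have fE a : f a = c * \val a + (lambda == 0)%:R * f 0 + h a.
  by rewrite -f0E /h; ring.
have rigid := cocycle_rigid one1 hc h0 h1.
have [l2|l2] := eqVneq lambda (-2).
  rewrite {}l2 in hc fE *.
  (* 6 is the value of x^3 - x at x = 2 *)
  pose k := h (one + one) / 6.
  have := cocycle_comb k hc (cocycle_comb 1 cocycle_cube (@cocycle_val _)).
  move=> /(cocycle_rigid_N2 one1) hE.
  exists (c - k), (f 0), 0, k => a.
  have {}hE : h a - k * (\val a ^+ 3 - 1 * \val a) = 0.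
    apply: hE; rewrite ?valE one1 ?h1; first by ring.
    by rewrite /k; field.
  by rewrite fE mulr1n; apply: (eq_by_comb (k := 1) hE); ring.
(* at lambda = -1, where x^2 - x is a cocycle taking the value 2 at -1 *)
pose s := (lambda == -1)%:R * h (- one) / 2.
have hE a : h a = s * (\val a ^+ 2 - \val a).
  have ne0 : (1 - lambda) * (2 + lambda) != 0.
    by rewrite mulf_neq0 ?subr_eq0 1?(eq_sym 1) // addrC addr_eq0.
  apply: (mulfI ne0); rewrite rigid /s.
  have [->|lN1] := eqVneq lambda (-1); first by rewrite mulr1n; field.
  have /eqP := cocycle_N1 one1 hc h0 h1.
  rewrite mulf_eq0 addrC addr_eq0 (negPf lN1) => /eqP ->; ring.
exists (c - s), (f 0), s, 0 => a; rewrite fE hE.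
by rewrite /s; case: (lambda == -1); rewrite ?mulr1n ?mulr0n; ring.
Qed.

End FunctionalEquations.

(** * Derivations and their degrees *)

Section LinearMaps.
Variables (F : fieldType) (U V : lmodType F) (s : U -> V).
Hypothesis s_lin : linear s.

Lemma lin_fun0 : s 0 = 0.
Proof.
have := s_lin 1 0 0; rewrite !scale1r addr0 => e.
by apply: (addIr (s 0)); rewrite add0r -e.
Qed.

Lemma lin_funZ k x : s (k *: x) = k *: s x.
Proof. by rewrite -[k *: x]addr0 s_lin lin_fun0 addr0. Qed.

Lemma lin_funD x y : s (x + y) = s x + s y.
Proof. by have := s_lin 1 x y; rewrite !scale1r. Qed.

End LinearMaps.

Lemma scaler_comb2 (F : fieldType) (V : lmodType F) (u v : V) k p q :
  k *: (p *: u + q *: v) = (k * p) *: u + (k * q) *: v.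
Proof. by rewrite scalerDr !scalerA. Qed.

Lemma add_comb2 (F : fieldType) (V : lmodType F) (u v : V) p q p' q' :
  p *: u + q *: v + (p' *: u + q' *: v) = (p + p') *: u + (q + q') *: v.
Proof. by rewrite addrACA -!scalerDl. Qed.

Section LieTheory.
Variables (F : fieldType) (L : lieAlgType F).
Implicit Types (x y z : L).

Lemma lieDl x y z : lie (x + y) z = lie x z + lie y z.
Proof. exact: lin_funD (lie_linearl z) x y. Qed.

Lemma lieDr x y z : lie z (x + y) = lie z x + lie z y.
Proof. exact: lin_funD (lie_linearr z) x y. Qed.

Lemma lieZl k x z : lie (k *: x) z = k *: lie x z.
Proof. exact: lin_funZ (lie_linearl z) k x. Qed.

Lemma lieZr k x z : lie z (k *: x) = k *: lie z x.
Proof. exact: lin_funZ (lie_linearr z) k x. Qed.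

Lemma lie0l x : lie 0 x = 0.
Proof. exact: lin_fun0 (lie_linearl x). Qed.

Lemma lie0r x : lie x 0 = 0.
Proof. exact: lin_fun0 (lie_linearr x). Qed.

Lemma lie_antisym x y : lie x y = - lie y x.
Proof.
apply/eqP; rewrite -addr_eq0; apply/eqP.
by have := lie_alt (x + y); rewrite lieDl !lieDr !lie_alt add0r addr0.
Qed.

Lemma derivation_ad x : derivation (ad x).
Proof.
split=> [|y z]; first exact: lie_linearr.
rewrite /ad (lie_antisym (lie x y)).
have /eqP := lie_jacobi x y z; rewrite addr_eq0 => /eqP <-.
rewrite -addrA [X in _ + X](_ : _ = 0) ?addr0 // [lie z x]lie_antisym.
by rewrite -scaleN1r lieZr scaleN1r addNr.
Qed.

Lemma derivation0 : derivation (fun _ : L => 0).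
Proof.
split=> [k x y|x y]; first by rewrite scaler0 addr0.
by rewrite lie0l lie0r addr0.
Qed.

Lemma derivation_comb k (s t : L -> L) :
  derivation s -> derivation t -> derivation (k *: s + t).
Proof.
move=> [sl sD] [tl tD]; split=> [c x y|x y]; rewrite !fctE.
  rewrite sl tl !scalerDr !scalerA [k * c]mulrC addrACA.
  by rewrite -!addrA.
by rewrite sD tD lieDl lieDr lieZl lieZr scalerDr addrACA.
Qed.

End LieTheory.

Section Generators.
Variables (C : numFieldType) (G : zmodClosed C) (lambda : C).
Local Notation T := (carrier G).
Local Notation g := (galg G lambda).
Local Notation L_ := (Lgen lambda).
Local Notation I_ := (Igen lambda).
Implicit Types (a b : T) (x y : g).

Lemma lieLL a b : lie (L_ a) (L_ b) = (\val b - \val a) *: L_ (a + b).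
Proof. exact: gbracketLL. Qed.

Lemma lieLI a b : lie (L_ a) (I_ b) = (\val b - lambda * \val a) *: I_ (a + b).
Proof. exact: gbracketLI. Qed.

Lemma lieIL a b : lie (I_ a) (L_ b) = (lambda * \val b - \val a) *: I_ (a + b).
Proof. by rewrite [LHS]gbracketIL [b + a]addrC -scaleNr opprB. Qed.

Lemma lieII a b : lie (I_ a) (I_ b) = 0.
Proof. exact: gbracketII. Qed.

Lemma lie_combL a b p q : lie (p *: L_ a + q *: I_ a) (L_ b) =
  (p * (\val b - \val a)) *: L_ (a + b) +
  (q * (lambda * \val b - \val a)) *: I_ (a + b).
Proof. by rewrite lieDl !lieZl lieLL lieIL !scalerA. Qed.

Lemma lie_combI a b p q : lie (p *: L_ a + q *: I_ a) (I_ b) =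
  (p * (\val b - lambda * \val a)) *: I_ (a + b).
Proof. by rewrite lieDl !lieZl lieLI lieII scaler0 addr0 scalerA. Qed.

Lemma lieL_comb a b p q : lie (L_ a) (p *: L_ b + q *: I_ b) =
  (p * (\val b - \val a)) *: L_ (a + b) +
  (q * (\val b - lambda * \val a)) *: I_ (a + b).
Proof. by rewrite lieDr !lieZr lieLL lieLI !scalerA. Qed.

Lemma lieI_comb a b p q : lie (I_ a) (p *: L_ b + q *: I_ b) =
  (p * (lambda * \val b - \val a)) *: I_ (a + b).
Proof. by rewrite lieDr !lieZr lieIL lieII scaler0 addr0 scalerA. Qed.

Lemma eq_on_generators (V : lmodType C) (s t : g -> V) : linear s -> linear t ->
  (forall a, s (L_ a) = t (L_ a)) -> (forall a, s (I_ a) = t (I_ a)) -> s = t.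
Proof.
move=> sl tl sL sI; apply/funext; apply: galg_ind => // [|k x y sx sy].
  by rewrite (lin_fun0 sl) (lin_fun0 tl).
by rewrite sl tl sx sy.
Qed.

Lemma LI_free a p q p' q' :
  p *: L_ a + q *: I_ a = p' *: L_ a + q' *: I_ a -> p = p' /\ q = q'.
Proof.
pose cL : g -> C^o := gext (fun b => (b == a)%:R) (fun=> 0).
pose cI : g -> C^o := gext (fun=> 0) (fun b => (b == a)%:R).
have cLE r t : cL (r *: L_ a + t *: I_ a) = r.
  rewrite [LHS]gext_linear (lin_funZ (gext_linear _ _)) gextL gextI eqxx scaler0 addr0.
  exact: mulr1.
have cIE r t : cI (r *: L_ a + t *: I_ a) = t.
  rewrite [LHS]gext_linear (lin_funZ (gext_linear _ _)) gextL gextI eqxx scaler0 add0r.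
  exact: mulr1.
by move=> e; split; [rewrite -(cLE p q) e cLE | rewrite -(cIE p q) e cIE].
Qed.

Lemma ghomP a x : ghom lambda a x <-> exists p q, x = p *: L_ a + q *: I_ a.
Proof. exact: lspan2P. Qed.

(** By antisymmetry of the bracket the pairs (I, L) follow from the pairs
    (L, I). *)
Lemma derivation_on_generators (s : g -> g) : linear s ->
  (forall a b, s (lie (L_ a) (L_ b)) = lie (s (L_ a)) (L_ b) + lie (L_ a) (s (L_ b))) ->
  (forall a b, s (lie (L_ a) (I_ b)) = lie (s (L_ a)) (I_ b) + lie (L_ a) (s (I_ b))) ->
  (forall a b, s (lie (I_ a) (I_ b)) = lie (s (I_ a)) (I_ b) + lie (I_ a) (s (I_ b))) ->
  derivation s.
Proof.
move=> sl sLL sLI sII; split=> //.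
have sN x : s (- x) = - s x by rewrite -!scaleN1r (lin_funZ sl).
have swap x y : s (lie x y) = lie (s x) y + lie x (s y) ->
    s (lie y x) = lie (s y) x + lie y (s x).
  move=> e; rewrite lie_antisym sN e (lie_antisym (s y)) (lie_antisym y).
  by rewrite opprD addrC.
have extend y : (forall a, s (lie (L_ a) y) = lie (s (L_ a)) y + lie (L_ a) (s y)) ->
    (forall a, s (lie (I_ a) y) = lie (s (I_ a)) y + lie (I_ a) (s y)) ->
    forall x, s (lie x y) = lie (s x) y + lie x (s y).
  move=> hL hI; apply: galg_ind => // [|k u v hu hv].
    by rewrite lie0l (lin_fun0 sl) !lie0l addr0.
  by rewrite sl !lie_linearl sl hu hv scalerDr addrACA.
move=> x y; move: x; apply: (extend y) => a; apply: (swap y); move: y.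
  by apply: (extend (L_ a)) => b; [exact: sLL | exact/swap/sLI].
by apply: (extend (I_ a)) => b; [exact: sLI | exact: sII].
Qed.

Lemma Der_on_generators a (s : g -> g) : derivation s ->
  (forall b, ghom lambda (a + b) (s (L_ b))) ->
  (forall b, ghom lambda (a + b) (s (I_ b))) -> Der lambda a s.
Proof.
move=> sD sL sI; split=> // b _ [x /ghomP [p [q ->]] <-]; case: sD => sl _.
by rewrite sl (lin_funZ sl); apply: lspan_comb (sL b) (lspanZ _ (sI b)).
Qed.

Lemma Der_generators a (s : g -> g) : Der lambda a s ->
  (forall b, ghom lambda (a + b) (s (L_ b))) /\
  (forall b, ghom lambda (a + b) (s (I_ b))).
Proof.
move=> [_ sdeg]; split=> b; apply: sdeg; eexists; try reflexivity;
  apply: mem_lspan; by [left | right].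
Qed.

Lemma lspan_sub_Der a (S : set (g -> g)) : S `<=` Der lambda a ->
  lspan S `<=` Der lambda a.
Proof.
apply: lspan_min.
  by apply: Der_on_generators => [|b|b];
    [exact: derivation0 | exact: lspan0 | exact: lspan0].
move=> k s t sD tD; have [sL sI] := Der_generators sD; have [tL tI] := Der_generators tD.
apply: Der_on_generators => [|b|b]; first exact: derivation_comb sD.1 tD.1.
  exact: lspan_comb (sL b) (tL b).
exact: lspan_comb (sI b) (tI b).
Qed.

Lemma Der_adL a : Der lambda a (ad (L_ a)).
Proof.
apply: Der_on_generators => [|b|b]; first exact: derivation_ad.
  by apply/ghomP; exists (\val b - \val a), 0; rewrite /ad lieLL scale0r addr0.
by apply/ghomP; exists 0, (\val b - lambda * \val a);
  rewrite /ad lieLI scale0r add0r.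
Qed.

Lemma Der_adI a : Der lambda a (ad (I_ a)).
Proof.
apply: Der_on_generators => [|b|b]; first exact: derivation_ad.
  by apply/ghomP; exists 0, (lambda * \val b - \val a);
    rewrite /ad lieIL scale0r add0r.
by apply/ghomP; exists 0, 0; rewrite /ad lieII !scale0r addr0.
Qed.

Lemma lieL0_ghom a x : ghom lambda a x -> lie (L_ 0) x = \val a *: x.
Proof.
move=> /ghomP [p [q ->]]; rewrite lieL_comb !valE mulr0 subr0 add0r scaler_comb2.
by rewrite [p * _]mulrC [q * _]mulrC.
Qed.

(** The grading is by eigenvalues of ad L_0, so comparing the action of L_0 before
    and after s gives s = ad (- s(L_0) / a). *)
Lemma Der_inner a : a != 0 ->
  Der lambda a = lspan [set ad (L_ a); ad (I_ a)].
Proof.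
move=> a0; apply/seteqP; split; last first.
  by apply: lspan_sub_Der => _ [|] ->; [exact: Der_adL | exact: Der_adI].
move=> s sDer; have [sL sI] := Der_generators sDer; case: sDer => -[sl sD] _.
have va0 : \val a != 0 by rewrite val_carrier_eq0.
have sE b x : ghom lambda b x -> ghom lambda (a + b) (s x) ->
    s x = - (\val a)^-1 *: lie (s (L_ 0)) x.
  move=> bx bsx; apply: (scalerI va0); rewrite scalerA mulrN divff // scaleN1r.
  have := sD (L_ 0) x; rewrite (lieL0_ghom bx) (lieL0_ghom bsx) (lin_funZ sl).
  move=> e; apply/eqP; rewrite -addr_eq0 addrC; apply/eqP.
  apply: (addIr (\val b *: s x)); rewrite add0r -addrA -scalerDl -raddfD.
  by rewrite e.
have /ghomP [p [q sL0]] := sL 0; rewrite addr0 in sL0.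
apply/lspan2P; exists (- (\val a)^-1 * p), (- (\val a)^-1 * q).
have -> : (- (\val a)^-1 * p) *: ad (L_ a) + (- (\val a)^-1 * q) *: ad (I_ a) =
    ad (- (\val a)^-1 *: s (L_ 0)).
  by apply/funext => x; rewrite !fctE /ad sL0 lieZl lieDl !lieZl scaler_comb2.
apply: eq_on_generators => // [|b|b]; first exact: lie_linearr.
  by rewrite /ad lieZl; apply: (sE b) => //; apply: mem_lspan; left.
by rewrite /ad lieZl; apply: (sE b) => //; apply: mem_lspan; right.
Qed.

(** * Derivations of degree zero *)

(** A converse of [derivation_components] for maps without L-component on the
    I_a; every generator in degree zero is of this form. *)
Lemma Der0_on_generators (s : g -> g) (A B D : T -> C) : linear s ->
  (forall a, s (L_ a) = A a *: L_ a + B a *: I_ a) ->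
  (forall a, s (I_ a) = D a *: I_ a) ->
  (forall a b, A (a + b) = A a + A b) -> cocycle lambda B ->
  (forall a b, D (a + b) = A a + D b) -> Der lambda 0 s.
Proof.
move=> sl sL sI AD Bc DD; apply: Der_on_generators => [|b|b]; last 2 first.
- by apply/ghomP; exists (A b), (B b); rewrite add0r.
- by apply/ghomP; exists 0, (D b); rewrite add0r scale0r add0r.
apply: derivation_on_generators => // a b.
- rewrite lieLL (lin_funZ sl) !sL lie_combL lieL_comb scaler_comb2 add_comb2.
  rewrite -mulrDl -AD [A (a + b) * _]mulrC Bc.
  suff -> : B a * (lambda * \val b - \val a) + B b * (\val b - lambda * \val a) =
    (\val b - lambda * \val a) * B b - (\val a - lambda * \val b) * B a by [].
  by ring.
- rewrite lieLI (lin_funZ sl) sL !sI lie_combI lieZr lieLI !scalerA -scalerDl -mulrDl.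
  by rewrite DD mulrC.
by rewrite !sI lieZl lieZr !lieII (lin_fun0 sl) !scaler0 addr0.
Qed.

Lemma Der0_psi : Der lambda 0 (psi G lambda).
Proof.
apply: (@Der0_on_generators _ (fun=> 0) (fun=> 0) (fun=> 1)).
- exact: gext_linear.
- by move=> a; rewrite /psi gextL !scale0r addr0.
- by move=> a; rewrite /psi gextI scale1r.
- by move=> _ _; rewrite addr0.
- by apply: cocycle_const; rewrite mulr0.
by move=> _ _; rewrite add0r.
Qed.

Lemma Der0_xi (A : {additive T -> C}) : Der lambda 0 (xi lambda A).
Proof.
apply: (@Der0_on_generators _ A (fun=> 0) A).
- exact: gext_linear.
- by move=> a; rewrite /xi gextL scale0r addr0.
- by move=> a; rewrite /xi gextI.
- exact: raddfD.
- by apply: cocycle_const; rewrite mulr0.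
exact: raddfD.
Qed.

Lemma Der0_cocycle (B : T -> C) : cocycle lambda B ->
  Der lambda 0 (gext (fun a => B a *: I_ a) (fun=> 0)).
Proof.
move=> Bc; apply: (@Der0_on_generators _ (fun=> 0) B (fun=> 0)) => //.
- exact: gext_linear.
- by move=> a; rewrite gextL scale0r add0r.
- by move=> a; rewrite gextI scale0r.
- by move=> _ _; rewrite addr0.
by move=> _ _; rewrite addr0.
Qed.

Lemma homogeneous_coords (f : T -> g) : (forall a, ghom lambda (0 + a) (f a)) ->
  exists A B : T -> C, forall a, f a = A a *: L_ a + B a *: I_ a.
Proof.
move=> fa; have /choice[h hP] a : exists pq, f a = pq.1 *: L_ a + pq.2 *: I_ a.
  by have /ghomP := fa a; rewrite add0r => -[p [q ->]]; exists (p, q).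
by exists (fst \o h), (snd \o h).
Qed.

(** The Leibniz rule on the pairs (L, L), (L, I) and (I, I), read off coefficient
    by coefficient. *)
Lemma derivation_components (s : g -> g) (A B E D : T -> C) : derivation s ->
  (forall a, s (L_ a) = A a *: L_ a + B a *: I_ a) ->
  (forall a, s (I_ a) = E a *: L_ a + D a *: I_ a) ->
  [/\ forall a b, (\val b - \val a) * A (a + b) = (\val b - \val a) * (A a + A b),
      cocycle lambda B,
      forall a b, (\val b - lambda * \val a) * E (a + b) = (\val b - \val a) * E b,
      forall a b, (\val b - lambda * \val a) * D (a + b) =
        (\val b - lambda * \val a) * (A a + D b) &
      forall a b, E a * (\val b - lambda * \val a) + E b * (lambda * \val b - \val a) = 0].
Proof.
move=> [sl sD] sL sI.
have LL a b : (\val b - \val a) * A (a + b) = (\val b - \val a) * (A a + A b) /\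
    (\val b - \val a) * B (a + b) =
    (\val b - lambda * \val a) * B b - (\val a - lambda * \val b) * B a.
  have := sD (L_ a) (L_ b).
  rewrite lieLL (lin_funZ sl) !sL lie_combL lieL_comb scaler_comb2 add_comb2.
  by move=> /LI_free [-> ->]; split; ring.
have LI a b : (\val b - lambda * \val a) * E (a + b) = (\val b - \val a) * E b /\
    (\val b - lambda * \val a) * D (a + b) = (\val b - lambda * \val a) * (A a + D b).
  have := sD (L_ a) (I_ b).
  rewrite lieLI (lin_funZ sl) sL !sI lie_combI lieL_comb scaler_comb2.
  rewrite [RHS]addrCA -scalerDl => /LI_free [-> ->].
  by split; ring.
have II a b : E a * (\val b - lambda * \val a) + E b * (lambda * \val b - \val a) = 0.
  have := sD (I_ a) (I_ b).
  rewrite lieII (lin_fun0 sl) !sI lie_combI lieI_comb -scalerDl => e.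
  set p := (X in X = 0); suff /LI_free [] : 0 *: L_ (a + b) + p *: I_ (a + b) =
    0 *: L_ (a + b) + 0 *: I_ (a + b) by [].
  by rewrite -e !scale0r.
by split=> a b; [have [] := LL a b | have [] := LL a b | have [] := LI a b |
  have [] := LI a b | exact: II].
Qed.

End Generators.

Section DegreeZero.
Variables (C : numFieldType) (G : zmodClosed C) (lambda : C).
Local Notation T := (carrier G).
Variable one : T.
Hypothesis one1 : \val one = 1.
Local Notation g := (galg G lambda).
Local Notation L_ := (Lgen lambda).
Local Notation I_ := (Igen lambda).

(** Setting b = 0 in both equations gives E(0) = 0 and lambda E = 0.  The second
    equation then makes E proportional to a |-> a, and the first one at (1, 1)
    reads 0 = 2 E(1). *)
Lemma no_IL_component (E : T -> C) :
  (forall a b, (\val b - lambda * \val a) * E (a + b) = (\val b - \val a) * E b) ->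
  (forall a b, E a * (\val b - lambda * \val a) + E b * (lambda * \val b - \val a) = 0) ->
  forall a, E a = 0.
Proof.
move=> LI II.
have lE a : a != 0 -> lambda * E a = 0 /\ E 0 = 0.
  rewrite -val_carrier_eq0 => a0.
  have := LI a 0; have := II a 0; rewrite addr0 val_carrier0 => e1 e2.
  have E0 : E 0 = 0.
    have two0 : (2 : C) != 0 by rewrite pnatr_eq0.
    apply: (mulfI two0); apply: (mulfI a0).
    apply: (eq_by_comb (k := - 1) e1).
    by apply: (eq_by_comb (k := 1) e2); ring.
  split=> //; apply: (mulfI a0); move: e2; rewrite E0 => e2.
  by apply: (eq_by_comb (k := - 1) e2); ring.
have one0 : one != 0 by rewrite -val_carrier_eq0 one1 oner_eq0.
have E0 : E 0 = 0 by have [] := lE one one0.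
have {}lE a : lambda * E a = 0.
  by have [->|/lE[]//] := eqVneq a 0; rewrite E0 mulr0.
have Elin a : E a = \val a * E one.
  have := II one a; rewrite one1 => e.
  apply: (eq_by_comb (k := - 1) e).
  apply: (eq_by_comb (k := - 1) (lE one)).
  by apply: (eq_by_comb (k := \val a) (lE a)); ring.
have E1 : E one = 0.
  have := LI one one; rewrite Elin !valE one1 => e; have le := lE one.
  suff /eqP : 2 * E one = 0 by rewrite mulf_eq0 pnatr_eq0 => /eqP.
  by apply: (eq_by_comb (k := 1) e); apply: (eq_by_comb (k := 2) le); ring.
by move=> a; rewrite Elin E1 mulr0.
Qed.

(** D - A takes equal values at b and a + b whenever b != lambda a, so every value
    can be compared with the one at 0: through b = 0 if lambda != 0, and through
    a + b = 0 otherwise. *)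
Lemma II_component (A D : T -> C) : (forall a b, A (a + b) = A a + A b) ->
  (forall a b, (\val b - lambda * \val a) * D (a + b) =
    (\val b - lambda * \val a) * (A a + D b)) ->
  forall a, D a = A a + D 0.
Proof.
move=> AD LI a.
have [->|a0] := eqVneq a 0.
  by rewrite -[LHS]add0r; congr (_ + _); apply: (addIr (A 0)); rewrite -AD addr0 add0r.
have [l0|l0] := eqVneq lambda 0.
  have := LI (- a) a; rewrite addNr l0 mul0r subr0 => /mulfI ->; last first.
    by rewrite val_carrier_eq0.
  rewrite addrA -AD subrr -[LHS]add0r; congr (_ + _).
  by apply: (addIr (A 0)); rewrite -AD addr0 add0r.
have := LI a 0; rewrite addr0 val_carrier0 sub0r => /mulfI; apply.
by rewrite oppr_eq0 mulf_neq0 // val_carrier_eq0.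
Qed.

Lemma exists_additive (f : T -> C) : (forall a b, f (a + b) = f a + f b) ->
  exists A : {additive T -> C}, forall a, A a = f a.
Proof.
move=> fD.
have fB : zmod_morphism f.
  by move=> a b; apply: (addIr (f b)); rewrite -fD !subrK.
pose A : {additive T -> C} := HB.pack f (GRing.isZmodMorphism.Build T C f fB).
by exists A.
Qed.

(** The four exceptional values of lambda are those for which the Witt algebra has
    cocycles other than multiples of a |-> a; they produce sigma_(0), sigma_(-1),
    sigma_(-2) and eta_(A,1). *)
Lemma cocycleP (B : T -> C) : cocycle lambda B ->
  exists c s0 s1 s2 (A : {additive T -> C}), forall a, B a = c * \val a +
    (lambda == 0)%:R * s0 + (lambda == -1)%:R * s1 * \val a ^+ 2 +
    (lambda == -2)%:R * s2 * \val a ^+ 3 + (lambda == 1)%:R * A a.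
Proof.
move=> Bc; have [l1|l1] := eqVneq lambda 1; last first.
  have [c [s0 [s1 [s2 BE]]]] := cocycle_classification one1 l1 Bc.
  by exists c, s0, s1, s2, (\0 : {additive T -> C}) => a; rewrite BE mul0r addr0.
have [|A AE] := @exists_additive B.
  apply: (additive_off_diagonal one1) => a b; rewrite Bc l1; ring.
by exists 0, 0, 0, 0, A => a; rewrite AE mulr1n; ring.
Qed.

Lemma Der_degree0 : Der lambda (0 : T) =
  lspan ([set phi G lambda; psi G lambda;
              sigma0 G lambda; sigmaN1 G lambda; sigmaN2 G lambda]
         `|` range (@xi _ G lambda) `|` range (@eta1 _ G lambda)).
Proof.
set S := (X in lspan X).
have S_Der : S `<=` Der lambda 0.
  move=> _ [[[[[[->|->]|->]|->]|->]|[A _ <-]]|[A _ <-]].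
  - exact/Der0_cocycle/cocycle_val.
  - exact: Der0_psi.
  - apply/Der0_cocycle/cocycle_const.
    by case: eqP => [->|_]; rewrite ?mul0r ?mulr0.
  - by apply/Der0_cocycle/cocycle_delta => ->; exact: cocycle_sqr.
  - by apply/Der0_cocycle/cocycle_delta => ->; exact: cocycle_cube.
  - exact: Der0_xi.
  by apply/Der0_cocycle/cocycle_delta => ->; exact: cocycle_additive.
apply/seteqP; split; last exact: lspan_sub_Der.
move=> s sDer; have [sL sI] := Der_generators sDer.
have [A0 [B {}sL]] := homogeneous_coords sL; have [E [D {}sI]] := homogeneous_coords sI.
have [AE Bc EE DE II] := derivation_components sDer.1 sL sI.
have {AE} AD := additive_off_diagonal one1 AE.
have {EE II} E0 := no_IL_component EE II.
have {DE} DE := II_component AD DE.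
have [A AE] := exists_additive AD.
have [c [s0 [s1 [s2 [A' BE]]]]] := cocycleP Bc.
pose t : g -> g := D 0 *: psi G lambda + (1 *: xi lambda A + (1 *: eta1 lambda A' +
  (c *: phi G lambda + (s0 *: sigma0 G lambda + (s1 *: sigmaN1 G lambda +
  s2 *: sigmaN2 G lambda))))).
have St : lspan S t.
  do ![apply: lspan_comb; first apply: mem_lspan]; last apply/lspanZ/mem_lspan.
  - by do 2!left; do 3!left; right.
  - by left; right; exists A.
  - by right; exists A'.
  - by do 2!left; do 4!left.
  - by do 2!left; do 2!left; right.
  - by do 2!left; do 1!left; right.
  - by do 2!left; right.
suff -> : s = t by [].
apply: eq_on_generators => [||a|a].
- exact: sDer.1.1.
- exact: (lspan_sub_Der S_Der St).1.1.
- rewrite sL /t !fctE /xi /eta1 /phi /sigma0 /sigmaN1 /sigmaN2 /psi !gextL.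
  rewrite scaler0 [RHS]add0r !scalerA -!scalerDl mul1r AE.
  set b := (X in _ = _ + X *: _).
  suff -> : B a = b by [].
  by rewrite BE /b; ring.
rewrite sI /t !fctE /xi /eta1 /phi /sigma0 /sigmaN1 /sigmaN2 /psi !gextI.
by rewrite E0 scale0r [LHS]add0r DE scalerDl AE !scaler0 !addr0 scale1r addrC.
Qed.

End DegreeZero.

Theorem theorem3p1 (R : realType) (G : zmodClosed R[i]) (lambda : R[i])
    (hZ : forall n : int, n%:~R \in G)
    (hinv : forall k : int, 1 < k -> (k%:~R)^-1 \notin G) :
  (forall a : carrier G, a != 0 ->
     Der lambda a =
     lspan [set ad (Lgen lambda a); ad (Igen lambda a)]) /\
  Der lambda (0 : carrier G) =
  lspan ([set phi G lambda; psi G lambda;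
              sigma0 G lambda; sigmaN1 G lambda; sigmaN2 G lambda]
         `|` range (@xi _ G lambda) `|` range (@eta1 _ G lambda)).
Proof.
split; first exact: Der_inner.
by apply: (@Der_degree0 _ _ _ (exist _ (1%:~R) (hZ 1))); rewrite /= mulr1z.
Qed.
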